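(* Let $I\subset\Bbbk[x_0,\dots,x_n]$ be a nonzero proper saturated Borel ideal with Hilbert polynomial $P:=P_I$. If $I\ne L^P_n$, then $\deg K_{L^P_n}>\deg K_I$; equivalently, $\deg HS_{L^P_n}>\deg HS_I$.
   Context: $\Bbbk$ is an algebraically closed field, $S=\Bbbk[x_0,\dots,x_n]$ standard graded. For a homogeneous ideal $I$, $H_I(i)=\dim_\Bbbk(S/I)_i$, $P_I$ is the Hilbert polynomial of $S/I$, and the Hilbert series $HS_I(T)=\sum_{i}H_I(i)T^i$ equals $K_I(T)/(1-T)^{n+1}$ for a polynomial $K_I\in\mathbb{Z}[T]$ (the $K$-polynomial); $\deg HS_I:=\deg K_I-(n+1)$. A monomial ideal $I$ is Borel if for every monomial $m\in I$, every variable $x_j$ dividing $m$ and every $i<j$, $m x_i/x_j\in I$; it is saturated if $(I:\langle x_0,\dots,x_n\rangle^\infty)=I$. Lexicographic order: $x^u>x^v$ if the first nonzero coordinate of $u-v$ is positive. For a homogeneous ideal $J$ with Hilbert function $H$, $L^H_n$ is the monomial ideal whose degree-$i$ piece is spanned by the $\dim_\Bbbk J_i$ lexicographically largest degree-$i$ monomials; for $P$ the Hilbert polynomial of a homogeneous ideal $J\subsetneq S$ with $\deg P<n$, the lexicographic ideal $L^P_n$ is the saturation of $L^{H_J}_n$ with respect to $\langle x_0,\dots,x_n\rangle$ (it depends only on $P$ and $n$). *)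

(* Defs.v *)
(* monomials are multinomials' 'X_{1..N} (exponent vectors
   of x_0, ..., x_n with N = n.+1); a monomial ideal is represented by the
   (boolean) set of monomials it contains. *)
From HB Require Import structures.
From mathcomp Require Import all_boot all_algebra.
From mathcomp Require Import mpoly.
From mathcomp Require Import boolp.

Set Implicit Arguments.
Unset Strict Implicit.
Unset Printing Implicit Defensive.

Section MonomialIdeals.
Variable N : nat.
Implicit Types (I : pred 'X_{1..N}) (u v : 'X_{1..N}).

Definition mon_ideal I : Prop := forall u v, I u -> I (u + v)%MM.

Definition mon_nonzero I : Prop := exists u, I u.

Definition mon_proper I : Prop := ~~ I 0%MM.

Definition mon_borel I : Prop :=
  forall u (i j : 'I_N), I u -> (i < j)%N -> (0 < u j)%N ->
    I (u - U_(j) + U_(i))%MM.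

(* saturation (I : <x_0,...,x_n>^oo): u is in it iff u * m^k is contained
   in I for some k, i.e. u * v in I for every monomial v of degree k. *)
Definition saturation I : pred 'X_{1..N} :=
  fun u => `[< exists k : nat, forall v, mdeg v = k -> I (u + v)%MM >].

Definition mon_saturated I : Prop := forall u, saturation I u = I u.

Definition dim_in I (d : nat) : nat :=
  #|[set v : 'X_{1..N < d.+1} | (mdeg v == d) && I v]|.

Definition hilb I (d : nat) : nat :=
  #|[set v : 'X_{1..N < d.+1} | (mdeg v == d) && ~~ I v]|.

Definition lex_gt u v : bool :=
  [exists i : 'I_N, [forall j : 'I_N, (j < i)%N ==> (u j == v j)]
                    && (v i < u i)%N].

(* L^{H_I}: in each degree d, the dim_k I_d lex-largest monomials of degree d *)
Definition lex_segment I : pred 'X_{1..N} :=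
  fun u => (#|[set v : 'X_{1..N < (mdeg u).+1} |
               (mdeg v == mdeg u) && lex_gt v u]| < dim_in I (mdeg u))%N.

(* L^P_n for P = P_I: the saturation of L^{H_I} *)
Definition lex_ideal I : pred 'X_{1..N} := saturation (lex_segment I).

(* coefficient of T^t in the K-polynomial K_I(T) = HS_I(T) (1 - T)^N *)
Definition Kcoef I (t : nat) : int :=
  (\sum_(j < N.+1 | (j <= t)%N)
     (-1) ^+ j * ('C(N, j) * hilb I (t - j))%:Z)%R.

Definition Kdeg_gt J I : Prop :=
  exists t, Kcoef J t != 0%R /\ forall s, (t <= s)%N -> Kcoef I s = 0%R.

End MonomialIdeals.

(* Main.v *)
(* A universal lexicographic ideal is the set V_g of all monomials lexicographically
   at least some monomial x^g, and its minimal generator of largest degree is x^g.  By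
   induction on k, for every nonzero Borel ideal I generated in x_0, ..., x_(k-1) there
   is such a V_g with the same Hilbert polynomial, with pointwise smaller Hilbert
   function, and with deg K_(V_g) > deg K_I unless I = V_g.  For the step let J be the
   colon ideal I : x_k^oo, with associated g of degree d, and count monomials in
   x_0, ..., x_k.  The function F = H_I - H_(V_g) has no gap beyond d, since J is
   generated in degrees <= d.  Put c = \sum_t F(t) and g' = g x_k^c; then H_(V_g') -
   H_(V_g) is the indicator of [d, d + c), so the partial sums of F dominate those of
   this indicator.  Moreover K_I = K_J + (1 - T)^(k+1) (H_I - H_J), so K_I can reach the
   degree of K_(V_g') only if F is the indicator itself; then J = V_g by induction, I
   omits one monomial of V_g in each degree of [d, d + c), and Borel moves force these
   to be x^g x_k^i, i.e. I = V_g'. *)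
Require Import Defs.
From HB Require Import structures.
From mathcomp Require Import all_boot all_algebra.
From mathcomp Require Import mpoly.
From mathcomp Require Import boolp.
From mathcomp Require Import zify ring.

Set Implicit Arguments.
Unset Strict Implicit.
Unset Printing Implicit Defensive.

Import GRing.Theory.

(** * Backward differences as multiplication by powers of 1 - T *)

Section Differences.
Implicit Types a b : nat -> int.

(** With the value 0 before index 0, this multiplies the generating series of [a] by 1 - T. *)
Definition diff a (t : nat) : int := (a t - (if t is s.+1 then a s else 0))%R.

Lemma diffD a b t : diff (fun s => a s + b s)%R t = (diff a t + diff b t)%R.
Proof. by rewrite /diff; case: t => [|t]; rewrite ?subr0 // opprD addrACA. Qed.

Lemma iter_diffD m a b t :
  iter m diff (fun s => a s + b s)%R t = (iter m diff a t + iter m diff b t)%R.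
Proof.
elim: m t => //= m IHm t; rewrite -diffD; congr (diff _ _).
by apply: funext => s; rewrite IHm.
Qed.

Lemma iter_diff_vanish m a T :
  (forall s, T <= s -> a s = 0%R) -> forall s, T + m <= s -> iter m diff a s = 0%R.
Proof.
move=> aT; elim: m => [|m IHm] s; first by rewrite addn0; apply: aT.
case: s => [|s]; rewrite ?addnS // ltnS => le_s /=.
by rewrite /diff !IHm ?subr0 // leqW.
Qed.

(** The leading coefficient of (1 - T)^m is (-1)^m. *)
Lemma iter_diff_top m a T :
  (forall s, T < s -> a s = 0%R) -> iter m diff a (T + m) = ((-1) ^+ m * a T)%R.
Proof.
move=> aT; elim: m => [|m IHm] /=; first by rewrite addn0 mul1r.
rewrite addnS {1}/diff IHm (@iter_diff_vanish _ _ T.+1) // ?addSn //.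
by rewrite sub0r exprS mulN1r mulNr.
Qed.

(** Binomial expansion of (1 - T)^m, by induction on [m] with Pascal's rule. *)
Lemma iter_diffE m a t :
  iter m diff a t =
  (\sum_(j < m.+1 | (j <= t)%N) (-1) ^+ j * ('C(m, j)%:Z * a (t - j)%N))%R.
Proof.
(* Padding by zero removes the guard j <= t, so that sums over different ranges can be combined. *)
pose c t j : int := if (j <= t)%N then a (t - j) else 0%R.
have guard k s :
    (\sum_(j < k.+1 | (j <= s)%N) (-1) ^+ j * ('C(k, j)%:Z * a (s - j)%N) =
     \sum_(j < k.+1) (-1) ^+ j * ('C(k, j)%:Z * c s j))%R.
  rewrite big_mkcond; apply: eq_bigr => j _.
  by rewrite /c; case: ifP => //; rewrite !mulr0.
elim: m t => [|m IHm] t; rewrite guard.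
  by rewrite big_ord1 /c /= subn0 !mul1r.
have pascal s : (\sum_(j < m.+2) (-1) ^+ j * ('C(m.+1, j)%:Z * c s j) =
    \sum_(j < m.+1) (-1) ^+ j * ('C(m, j)%:Z * c s j) -
    \sum_(j < m.+1) (-1) ^+ j * ('C(m, j)%:Z * c s j.+1))%R.
  rewrite (_ : (\sum_(j < m.+1) (-1) ^+ j * ('C(m, j)%:Z * c s j))%R =
               (\sum_(j < m.+2) (-1) ^+ j * ('C(m, j)%:Z * c s j))%R); last first.
    by rewrite [RHS]big_ord_recr /= bin_small // mul0r mulr0 addr0.
  rewrite [LHS]big_ord_recl [X in (_ = X - _)%R]big_ord_recl !bin0 -addrA; congr (_ + _)%R.
  rewrite -sumrB; apply: eq_bigr => j _.
  by rewrite /= /bump leq0n add1n binS PoszD exprS; ring.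
rewrite pascal iterS /diff IHm guard; case: t => [|t].
  rewrite subr0 [in X in (_ - X)%R]big1 ?subr0 // => j _.
  by rewrite /c !mulr0.
by rewrite IHm guard.
Qed.

End Differences.

(** * Counting monomials of a given degree *)

Section Counting.
Variable N : nat.
Implicit Types (P Q : pred 'X_{1..N}) (u v w : 'X_{1..N}).

(** A list of unbounded monomials: the bounded type varies with [t], while here counts in different
    degrees can be compared by injections. *)
Definition monomials (t : nat) : seq 'X_{1..N} :=
  [seq v <- [seq val v | v : 'X_{1..N < t.+1}] | mdeg v == t].

Definition cnt P t := count P (monomials t).

Lemma mem_monomials v t : (v \in monomials t) = (mdeg v == t).
Proof.
rewrite mem_filter andb_idr // => /eqP vt.
have lt_v : (mdeg v < t.+1)%N by rewrite vt.
by apply/mapP; exists (BMultinom lt_v); rewrite ?mem_enum.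
Qed.

Lemma monomials_uniq t : uniq (monomials t).
Proof. by rewrite filter_uniq // map_inj_uniq ?enum_uniq //; apply: val_inj. Qed.

Lemma card_cnt P t : #|[set v : 'X_{1..N < t.+1} | (mdeg v == t) && P v]| = cnt P t.
Proof.
rewrite cardE /enum_mem size_filter /cnt /monomials count_filter count_map enumT.
by apply: eq_count => v; rewrite /= !inE andbC.
Qed.

Lemma cnt_le P Q t : (forall v, mdeg v = t -> P v -> Q v) -> cnt P t <= cnt Q t.
Proof.
move=> sPQ; rewrite /cnt -(@eq_in_count _ (predI P Q)); first by apply: sub_count => v /andP[].
by move=> v; rewrite mem_monomials => /eqP vt /=; apply: andb_idr; apply: sPQ.
Qed.

Lemma cnt_eq P Q t : (forall v, mdeg v = t -> P v = Q v) -> cnt P t = cnt Q t.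
Proof.
by move=> eqPQ; apply: eq_in_count => v; rewrite mem_monomials => /eqP; apply: eqPQ.
Qed.

Lemma cntID P Q t :
  cnt P t = (cnt (fun v => P v && Q v) t + cnt (fun v => P v && ~~ Q v) t)%N.
Proof.
rewrite /cnt -count_predUI [X in (_ + X)%N](@eq_count _ _ pred0) => [|v /=].
  by rewrite count_pred0 addn0; apply: eq_count => v /=; rewrite -andb_orr orbN andbT.
by case: (P v); case: (Q v).
Qed.

Lemma cnt_gt0 P t : reflect (exists2 v, mdeg v = t & P v) (0 < cnt P t)%N.
Proof.
rewrite -has_count; apply: (iffP hasP) => [[v]|[v vt Pv]].
  by rewrite mem_monomials => /eqP; exists v.
by exists v; rewrite // mem_monomials vt.
Qed.

Lemma cnt_eq0 P t : cnt P t = 0%N -> forall v, mdeg v = t -> ~~ P v.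
Proof.
move=> P0 v vt; apply/negP => Pv; suff: (0 < cnt P t)%N by rewrite P0.
by apply/cnt_gt0; exists v.
Qed.

Lemma cnt_pred1 u t : cnt (pred1 u) t = (mdeg u == t) :> nat.
Proof. by rewrite /cnt count_uniq_mem ?monomials_uniq // mem_monomials. Qed.

Lemma cnt_le1 P t u v :
  (cnt P t <= 1)%N -> mdeg u = t -> mdeg v = t -> P u -> P v -> u = v.
Proof.
move=> + ut vt Pu Pv; apply: contraTeq => neq_uv; rewrite -ltnNge /cnt -size_filter.
apply: (@uniq_leq_size _ [:: u; v]) => [|w]; first by rewrite /= inE neq_uv.
by rewrite !inE mem_filter mem_monomials => /pred2P[] ->; rewrite ?Pu ?Pv ?ut ?vt /=.
Qed.

Lemma cnt_inj P Q s t (f : 'X_{1..N} -> 'X_{1..N}) :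
    (forall v, mdeg v = s -> P v -> mdeg (f v) = t /\ Q (f v)) ->
    (forall u v, P u -> P v -> f u = f v -> u = v) ->
  cnt P s <= cnt Q t.
Proof.
move=> fPQ finj; rewrite /cnt -!size_filter -(size_map f).
apply: uniq_leq_size => [|_ /mapP[v + ->]].
  rewrite map_inj_in_uniq => [|u v]; first exact/filter_uniq/monomials_uniq.
  by rewrite mem_filter => /andP[Pu _]; rewrite mem_filter => /andP[Pv _]; apply: finj.
rewrite mem_filter mem_monomials => /andP[Pv /eqP vs].
by have [fvt Qfv] := fPQ v vs Pv; rewrite mem_filter Qfv mem_monomials fvt eqxx.
Qed.

End Counting.

(** * Ideals in the first variables and their Hilbert series *)

Section Variables.
Variable N : nat.
Implicit Types (I J P : pred 'X_{1..N}) (g u v w : 'X_{1..N}) (i j o : 'I_N).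

Definition in_vars (k : nat) : pred 'X_{1..N} :=
  fun v => [forall i : 'I_N, (k <= i)%N ==> (v i == 0%N)].

(** For a monomial ideal: it is extended from the polynomial ring in x_0, ..., x_(k-1). *)
Definition depends (k : nat) I : Prop :=
  forall u v, (forall i, (i < k)%N -> u i = v i) -> I u = I v.

Definition hilb_vars (k : nat) I (t : nat) : nat :=
  cnt (fun v => in_vars k v && ~~ I v) t.

Definition Kseries I : nat -> int := iter N diff (fun s => Posz (hilb I s)).

Lemma KcoefE I t : Kcoef I t = Kseries I t.
Proof. by rewrite /Kseries iter_diffE; apply: eq_bigr => j _; rewrite PoszM. Qed.

Lemma in_varsP k v : reflect (forall i, (k <= i)%N -> v i = 0%N) (in_vars k v).
Proof.
by apply: (iffP forallP) => v0 i; [move/(implyP (v0 i))/eqP | apply/implyP => /v0 ->].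
Qed.

Lemma in_vars_full v : in_vars N v.
Proof. by apply/in_varsP => i; rewrite leqNgt ltn_ord. Qed.

Lemma in_varsW k l v : (k <= l)%N -> in_vars k v -> in_vars l v.
Proof. by move=> le_kl /in_varsP v0; apply/in_varsP => i le_li; apply: v0; lia. Qed.

Lemma in_vars_addU k o v e : (o < k)%N -> in_vars k v -> in_vars k (v + U_(o) *+ e)%MM.
Proof.
move=> lt_ok /in_varsP v0; apply/in_varsP => i le_ki.
by rewrite mnmDE mulmnE mnm1E v0 //; case: eqVneq => [eq_oi|//]; move: lt_ok; rewrite eq_oi; lia.
Qed.

Lemma in_varsB k v w : in_vars k v -> in_vars k (v - w)%MM.
Proof. by move=> /in_varsP v0; apply/in_varsP => i le_ki; rewrite mnmBE v0. Qed.

Lemma dependsW k l I : (k <= l)%N -> depends k I -> depends l I.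
Proof. by move=> le_kl dI u v uv; apply: dI => i lt_ik; apply: uv; lia. Qed.

Lemma depends_addU k o I u e : (k <= o)%N -> depends k I -> I (u + U_(o) *+ e)%MM = I u.
Proof.
move=> le_ko dI; apply: dI => i lt_ik; rewrite mnmDE mulmnE mnm1E.
by case: eqVneq => [eq_oi|_]; [move: le_ko; rewrite eq_oi; lia | rewrite mul0n addn0].
Qed.

Lemma depends_subU k o I u : (k <= o)%N -> depends k I -> I (u - U_(o))%MM = I u.
Proof.
move=> le_ko dI; apply: dI => i lt_ik; rewrite mnmBE mnm1E.
by case: eqVneq => [eq_oi|_]; [move: le_ko; rewrite eq_oi; lia | rewrite subn0].
Qed.

Lemma depends_ext k I J : depends k I -> depends k J ->
  (forall u, in_vars k u -> I u = J u) -> I =1 J.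
Proof.
move=> dI dJ IJ u; pose u' := [multinom if (i < k)%N then u i else 0%N | i < N].
have uu' i : (i < k)%N -> u i = u' i by move=> lt_ik; rewrite mnmE lt_ik.
rewrite (dI _ _ uu') (dJ _ _ uu'); apply: IJ; apply/in_varsP => i le_ki.
by rewrite mnmE ltnNge le_ki.
Qed.

Lemma addUK o v : (0 < v o)%N -> (v - U_(o) + U_(o) = v)%MM.
Proof. by move=> v_gt0; rewrite submK // lep1mP -lt0n. Qed.

Lemma addU_coord g o e j : (j < o)%N -> (g + U_(o) *+ e)%MM j = g j.
Proof.
by move=> lt_jo; rewrite mnmDE mulmnE mnm1E; case: eqVneq lt_jo => [->|]; rewrite ?ltnn ?addn0.
Qed.

(** Division by x_o matches the monomials divisible by x_o with all monomials one degree lower, and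
    [P] does not see x_o. *)
Lemma cnt_in_varsS o P t : depends o P ->
  cnt (fun v => in_vars o.+1 v && P v) t =
  (cnt (fun v => in_vars o v && P v) t +
   (if t is s.+1 then cnt (fun v => in_vars o.+1 v && P v) s else 0))%N.
Proof.
move=> dP; rewrite (cntID _ (in_vars o)); congr (_ + _)%N.
  apply: cnt_eq => v _; case in_v: (in_vars o v); rewrite ?andbT ?andbF //.
  by rewrite (in_varsW _ in_v).
have vo v : in_vars o.+1 v -> ~~ in_vars o v -> (0 < v o)%N.
  move=> /in_varsP v0 /in_varsP vNo; rewrite lt0n; apply/eqP => v_o; apply: vNo => i.
  by rewrite leq_eqVlt => /predU1P[/val_inj <-//|]; apply: v0.
case: t => [|t].
  apply/eqP; rewrite -leqn0 leqNgt; apply/cnt_gt0 => -[v /eqP].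
  by rewrite mdeg_eq0 => /eqP -> /andP[/andP[/vo V _] /V]; rewrite mnm0E.
apply/eqP; rewrite eqn_leq; apply/andP; split.
  apply: (@cnt_inj _ _ _ _ _ (fun v => v - U_(o))%MM) => [v vt|u v].
    move=> /andP[/andP[in_v Pv] /(vo _ in_v) v_gt0]; split.
      by move: vt; rewrite -{1}(addUK v_gt0) mdegD mdeg1; lia.
    by rewrite in_varsB //= (depends_subU _ _ dP).
  move=> /andP[/andP[in_u _] /(vo _ in_u) u_gt0] /andP[/andP[in_v _] /(vo _ in_v) v_gt0] uv.
  by rewrite -(addUK u_gt0) uv addUK.
apply: (@cnt_inj _ _ _ _ _ (fun v => v + U_(o) *+ 1)%MM) => [v vt /andP[in_v Pv]|u v _ _].
  rewrite mdegD mulm1n mdeg1 vt addn1; split=> //.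
  rewrite -(mulm1n U_(o)) in_vars_addU // (depends_addU _ _ _ dP) // Pv /=.
  by apply/in_varsP => /(_ o (leqnn _)); rewrite mnmDE mulmnE mnm1E eqxx; lia.
exact: addIm.
Qed.

Lemma hilb_varsS o I t : depends o I ->
  hilb_vars o.+1 I t =
  (hilb_vars o I t + (if t is s.+1 then hilb_vars o.+1 I s else 0))%N.
Proof. by move=> dI; apply: (@cnt_in_varsS _ (fun v => ~~ I v)) => u v /dI ->. Qed.

Lemma hilb_vars_sum o I t : depends o I ->
  hilb_vars o.+1 I t = (\sum_(0 <= s < t.+1) hilb_vars o I s)%N.
Proof.
move=> dI; elim: t => [|t IHt]; rewrite (hilb_varsS _ dI) ?big_nat1 ?addn0 //.
by rewrite big_nat_recr //= -IHt addnC.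
Qed.

Lemma hilbE I t : hilb I t = hilb_vars N I t.
Proof.
rewrite /hilb (card_cnt (fun v => ~~ I v)).
by apply: cnt_eq => v _; rewrite in_vars_full.
Qed.

(** Each variable absent from the generators divides the Hilbert series by 1 - T, which cancels one
    application of [diff]. *)
Lemma Kseries_hilb_vars k I t : (k <= N)%N -> depends k I ->
  Kseries I t = iter k diff (fun s => Posz (hilb_vars k I s)) t.
Proof.
move=> le_kN dI.
have -> : Kseries I = iter N diff (fun s => Posz (hilb_vars N I s)).
  by congr (iter N diff _); apply: funext => s; rewrite hilbE.
have stable m : (m + k <= N)%N ->
    iter (m + k) diff (fun s => Posz (hilb_vars (m + k) I s)) t =
    iter k diff (fun s => Posz (hilb_vars k I s)) t; last first.
  by have := @stable (N - k)%N; rewrite subnK //; apply.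
elim: m => //= m IHm lt_m; rewrite -IHm; last lia.
have lt_o : (m + k < N)%N by lia.
have dmI : depends (Ordinal lt_o) I by apply: dependsW dI; apply: leq_addl.
rewrite -iterS iterSr; congr (iter _ diff _ t); apply: funext => s.
by rewrite /diff (hilb_varsS s dmI); case: s => [|s]; rewrite ?addn0 ?subr0 ?PoszD ?addrK.
Qed.

End Variables.

(** * The lexicographic order and the ideals V_g *)

Section Lex.
Variable N : nat.
Implicit Types (I : pred 'X_{1..N}) (g u v w : 'X_{1..N}) (i j o : 'I_N).

Lemma lex_gtP u v :
  reflect (exists2 i : 'I_N, forall j : 'I_N, (j < i)%N -> u j = v j & (v i < u i)%N) (lex_gt u v).
Proof.
apply: (iffP existsP) => [[i /andP[/forallP uv vu]]|[i uv vu]]; exists i => //.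
  by move=> j /(implyP (uv j))/eqP.
by rewrite vu andbT; apply/forallP => j; apply/implyP => /uv ->.
Qed.

Lemma lex_total u v : [\/ u = v, lex_gt u v | lex_gt v u].
Proof.
have [->|neq_uv] := eqVneq u v; first by constructor 1.
have [i0 neq_i0] : exists i, u i != v i.
  apply/existsP; apply: contraR neq_uv => /existsPn eq_uv; apply/eqP/mnmP => i.
  by apply/eqP; rewrite -[_ == _]negbK.
case: (@arg_minnP _ i0 (fun i => u i != v i) val) => // i neq_i min_i.
have eq_uv j : (j < i)%N -> u j = v j.
  by rewrite ltnNge; apply: contraNeq => /min_i.
by case: (ltngtP (u i) (v i)) neq_i => // lt_i _; [constructor 3 | constructor 2];
   apply/lex_gtP; exists i => // j /eq_uv.
Qed.

Lemma lex_trans v u w : lex_gt u v -> lex_gt v w -> lex_gt u w.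
Proof.
move=> /lex_gtP[i eq_uv lt_i] /lex_gtP[j eq_vw lt_j]; apply/lex_gtP.
case: (ltngtP i j) => [lt_ij|lt_ji|/val_inj eq_ij].
- by exists i => [l lt_li|]; [rewrite eq_uv ?eq_vw //; lia | rewrite -eq_vw].
- by exists j => [l lt_lj|]; [rewrite eq_uv ?eq_vw //; lia | rewrite eq_uv].
exists i => [l lt_li|]; first by rewrite eq_uv ?eq_vw // -eq_ij.
by apply: leq_ltn_trans lt_i; rewrite {1}eq_ij ltnW // -?eq_ij // eq_ij.
Qed.

Lemma lex_irr u : lex_gt u u = false.
Proof. by apply/lex_gtP => -[i _]; rewrite ltnn. Qed.

(* The ideal generated by x_0^(g_0 + 1), x_0^g_0 x_1^(g_1 + 1), ... and x^g itself. *)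
Definition lex_above g : pred 'X_{1..N} := fun u => ~~ lex_gt g u.

Lemma lex_gt_above g u : lex_gt u g -> lex_above g u.
Proof. by move=> gt_ug; apply/negP => /(lex_trans gt_ug); rewrite lex_irr. Qed.

Lemma lex_above_ideal g : mon_ideal (lex_above g).
Proof.
move=> u v; apply: contra => gt_guv.
case: (lex_total (u + v)%MM u) => [<-//|/(lex_trans gt_guv)//|/lex_gtP[i _]].
by rewrite mnmDE; lia.
Qed.

Lemma lex_above_up g u v : lex_above g u -> lex_gt v u -> lex_above g v.
Proof. by move=> + gt_vu; apply: contra => /lex_trans; apply. Qed.

(** Where [g] first exceeds a monomial it has a positive exponent, so the comparison is decided
    among the first [k] variables. *)
Lemma lex_above_depends k g : in_vars k g -> depends k (lex_above g).
Proof.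
move=> /in_varsP g0 u v uv; congr (~~ _).
have lexW (x y : 'X_{1..N}) : (forall i, (i < k)%N -> x i = y i) -> lex_gt g x -> lex_gt g y.
  move=> xy /lex_gtP[i gx lt_i].
  have lt_ik : (i < k)%N by rewrite ltnNge; apply: contraL lt_i => /g0 ->.
  apply/lex_gtP; exists i => [j lt_ji|]; last by rewrite -xy.
  by rewrite gx ?xy // (ltn_trans lt_ji).
by apply/idP/idP; apply: lexW => // i /uv.
Qed.

Lemma lex_above_addU_sub o g c u : in_vars o g ->
  lex_above (g + U_(o) *+ c)%MM u -> lex_above g u.
Proof.
move=> /in_varsP g0; apply: contra => /lex_gtP[i gu lt_i]; apply/lex_gtP.
have lt_io : (i < o)%N by rewrite ltnNge; apply: contraL lt_i => /g0 ->.
exists i => [j lt_ji|]; last by rewrite mnmDE; lia.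
rewrite mnmDE mulmnE mnm1E gu //; case: eqVneq => [eq_oj|]; last by rewrite addn0.
by move: lt_io; rewrite eq_oj; lia.
Qed.

(** A monomial in x_0, ..., x_o that is at least x^g and below x^g x_o^c agrees with [g] before x_o,
    so only its exponent of x_o is free. *)
Lemma lex_above_addUP o g c u : in_vars o g -> in_vars o.+1 u ->
  reflect (exists2 e, (e < c)%N & u = (g + U_(o) *+ e)%MM)
          (lex_above g u && ~~ lex_above (g + U_(o) *+ c)%MM u).
Proof.
move=> /in_varsP g0 /in_varsP u0; have gE e j : (g + U_(o) *+ e)%MM j = (g j + (o == j) * e)%N.
  by rewrite mnmDE mulmnE mnm1E.
have g_o j : (j < o)%N -> forall e, (g + U_(o) *+ e)%MM j = g j.
  by move=> lt_jo e; apply: addU_coord.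
rewrite negbK; apply: (iffP andP) => [[gt_u /lex_gtP[i eq_u]]|[e lt_ec ->]].
  rewrite gE; case: (ltngtP i o) => [lt_io|lt_oi|/val_inj eq_io].
  - rewrite -gE g_o // => lt_u; case/negP: gt_u; apply/lex_gtP; exists i => // j lt_ji.
    by rewrite -eq_u ?g_o // (ltn_trans lt_ji).
  - by case: eqVneq => [eq_oi|_]; [move: lt_oi; rewrite eq_oi; lia | rewrite g0 // ltnW].
  rewrite -eq_io eqxx mul1n g0 ?eq_io // => lt_uc; exists (u o); first by [].
  apply/mnmP => j; case: (ltngtP j o) => [lt_jo|lt_oj|/val_inj ->].
  - by rewrite -eq_u ?eq_io // !g_o.
  - by rewrite gE u0 // g0 ?(ltnW lt_oj) //; case: eqVneq lt_oj => // ->; rewrite ltnn.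
  by rewrite gE eqxx g0 // mul1n.
split; first by apply: lex_above_ideal; rewrite /lex_above lex_irr.
by apply/lex_gtP; exists o => [j lt_jo|]; [rewrite !g_o | rewrite !gE eqxx; lia].
Qed.

End Lex.

(** From [d] on, [F] is positive up to its first zero and vanishes afterwards. Its partial sums thus
    grow by at least 1 per step until they reach the total [c], whereas those of the indicator of
    [d, d + c) grow by exactly 1. *)
Lemma staircase (F : nat -> nat) (d M c : nat) :
    (forall t, (d <= t)%N -> F t = 0%N -> F t.+1 = 0%N) ->
    (forall t, (M <= t)%N -> F t = 0%N) ->
    c = (\sum_(0 <= s < M) F s)%N ->
  [/\ forall t, (\sum_(0 <= s < t) (d <= s < d + c) <= \sum_(0 <= s < t) F s)%N,
      forall t, (d + c <= t)%N ->
        (\sum_(0 <= s < t) (d <= s < d + c) = \sum_(0 <= s < t) F s)%N,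
      forall t, (d + c <= t)%N -> F t = 0%N
    & (0 < c)%N -> (0 < F (d + c).-1)%N -> forall t, F t = (d <= t < d + c)%N :> nat].
Proof.
move=> gap finF defc; pose G t := (\sum_(0 <= s < t) F s)%N.
have GS t : G t.+1 = (G t + F t)%N by rewrite /G big_nat_recr.
have G_M t : (M <= t)%N -> G t = c.
  elim: t => [|t IHt]; first by rewrite leqn0 => /eqP M0; rewrite defc M0.
  rewrite leq_eqVlt => /predU1P[<-|]; first by rewrite defc.
  by rewrite ltnS => le_Mt; rewrite GS IHt // finF // addn0.
have G_mono s e : (G s <= G (s + e))%N.
  by elim: e => [|e IHe]; rewrite ?addn0 // addnS GS; lia.
have G_le t : (G t <= c)%N by rewrite -(G_M (t + M)%N) ?leq_addl.
have F_zero t e : (d <= t)%N -> F t = 0%N -> F (t + e)%N = 0%N.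
  by move=> le_dt Ft; elim: e => [|e IHe]; rewrite ?addn0 // addnS gap //; lia.
have G_zero t : (d <= t)%N -> F t = 0%N -> G t = c.
  move=> le_dt Ft; rewrite -(G_M (t + M)%N) ?leq_addl //.
  by elim: M {finF defc G_M} => [|e IHe]; rewrite ?addn0 // addnS GS F_zero // addn0.
have F_pos t e : (d <= t)%N -> (0 < F (t + e))%N -> (0 < F t)%N.
  by move=> le_dt; rewrite !lt0n; apply: contraNneq => Ft; rewrite F_zero.
(* Positivity at d + e forces positivity at all of d, ..., d + e. *)
have G_pos e : (0 < F (d + e))%N -> (e < G (d + e).+1)%N.
  elim: e => [|e IHe] Fe; first by rewrite GS; lia.
  have /IHe lt_e : (0 < F (d + e))%N by apply: (F_pos _ 1%N); rewrite ?addn1 -?addnS // leq_addr.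
  by rewrite addnS GS in Fe *; lia.
have indE t : (\sum_(0 <= s < t) (d <= s < d + c))%N = minn c (t - d).
  by elim: t => [|t IHt]; rewrite ?big_nil ?big_nat_recr //= ?IHt; lia.
have F_out t : (d + c <= t)%N -> F t = 0%N.
  move=> le_t; apply/eqP; rewrite -leqn0 leqNgt; apply/negP.
  have -> : t = (d + (t - d))%N by lia.
  by move=> /G_pos; have := G_le (d + (t - d)).+1; lia.
have ind_le t : (\sum_(0 <= s < t) (d <= s < d + c) <= G t)%N.
  rewrite indE; case: t => [|t]; first lia.
  have [lt_td|le_dt] := ltnP t d; first lia.
  case: (posnP (F t)) => [/(G_zero _ le_dt) Gt|].
    by rewrite GS Gt; apply: leq_trans (geq_minl _ _) (leq_addr _ _).
  by rewrite -{1}(subnKC le_dt) => /G_pos; rewrite subnKC //; lia.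
have ind_eq t : (d + c <= t)%N -> (\sum_(0 <= s < t) (d <= s < d + c))%N = G t.
  by move=> le_t; rewrite indE G_zero ?F_out //; lia.
split=> // c_gt0 F_last t.
have ind_F s : ((d <= s < d + c) <= F s)%N.
  case: (boolP (d <= s < d + c)%N) => // /andP[le_ds lt_s].
  apply: (F_pos s ((d + c).-1 - s)%N le_ds); rewrite subnKC //; lia.
(* [F] dominates the indicator pointwise and has the same sum, hence equals it; the range is long
   enough to contain both [t] and the interval. *)
have /esym/eq_leq := ind_eq (t.+1 + (d + c))%N (leq_addl _ _).
rewrite -subn_eq0 /G -sumnB // big_mkord sum_nat_eq0 => /forallP.
have lt_t : (t < t.+1 + (d + c))%N by lia.
by move/(_ (Ordinal lt_t)); rewrite /= subn_eq0 => le_F; apply/eqP; rewrite eqn_leq le_F ind_F.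
Qed.

(** * Borel moves and the colon ideal *)

Section Borel.
Variable N : nat.
Implicit Types (I : pred 'X_{1..N}) (u v w : 'X_{1..N}) (i j o l : 'I_N).

Lemma mdeg_gt0P u : (0 < mdeg u)%N -> exists j, (0 < u j)%N.
Proof.
rewrite lt0n mdeg_eq0 => nz_u; apply/existsP; apply: contraR nz_u => /existsPn u0.
by apply/eqP/mnmP => j; rewrite mnm0E; apply/eqP; have := u0 j; rewrite lt0n negbK.
Qed.

Lemma mdeg_subU u l : (0 < u l)%N -> mdeg u = (mdeg (u - U_(l))%MM).+1.
Proof. by move=> u_gt0; rewrite -{1}(addUK u_gt0) mdegD mdeg1 addn1. Qed.

(** Borel moves exchange the factors x_o, one at a time, for the variables of [v], none of which
    comes after x_o. *)
Lemma borel_spread I o w v : mon_borel I -> in_vars o.+1 v ->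
  I (w + U_(o) *+ mdeg v)%MM -> I (w + v)%MM.
Proof.
move=> bI; have [m vm] : exists m, mdeg v = m by exists (mdeg v).
rewrite vm; elim: m v w vm => [|m IHm] v w vm in_v.
  by move/eqP: vm; rewrite mdeg_eq0 mulm0n => /eqP ->.
have [j v_gt0] : exists j, (0 < v j)%N by apply: mdeg_gt0P; rewrite vm.
have le_jo : (j <= o)%N.
  by rewrite leqNgt; apply: contraL v_gt0 => lt_oj; rewrite (in_varsP _ _ in_v).
have vm' : mdeg (v - U_(j))%MM = m by have := mdeg_subU v_gt0; lia.
move=> Iw; have -> : (w + v = w + U_(j) + (v - U_(j)))%MM.
  by rewrite -addmA [(U_(j) + _)%MM]addmC addUK.
apply: IHm => //; first exact: in_varsB.
have -> : (w + U_(j) + U_(o) *+ m = (w + U_(o) *+ m.+1) - U_(o) + U_(j))%MM.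
  by rewrite mulmSr addmA addmK -!addmA; congr (_ + _)%MM; rewrite addmC.
move: le_jo; rewrite leq_eqVlt => /predU1P[/val_inj ->|lt_jo].
  by rewrite addUK // mnmDE mulmnE mnm1E eqxx; lia.
by apply: bI => //; rewrite mnmDE mulmnE mnm1E eqxx; lia.
Qed.

(** The stable colon ideal I : x_o^oo. *)
Definition colon o I : pred 'X_{1..N} := fun u => `[< exists e, I (u + U_(o) *+ e)%MM >].

(** No minimal generator has degree above [d]; degree [d] itself is allowed. *)
Definition gen_below d I : Prop :=
  forall u, I u -> (d < mdeg u)%N -> exists2 l, (0 < u l)%N & I (u - U_(l))%MM.

Lemma sub_colon o I u : I u -> colon o I u.
Proof. by move=> Iu; apply/asboolP; exists 0%N; rewrite mulm0n addm0. Qed.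

Lemma colon_ideal o I : mon_ideal I -> mon_ideal (colon o I).
Proof.
move=> iI u v /asboolP[e Iu]; apply/asboolP; exists e.
by rewrite -addmA [(v + _)%MM]addmC addmA; apply: iI.
Qed.

Lemma colon_borel o I : mon_borel I -> mon_borel (colon o I).
Proof.
move=> bI u i j /asboolP[e Iu] lt_ij u_gt0; apply/asboolP; exists e.
have -> : (u - U_(j) + U_(i) + U_(o) *+ e = u + U_(o) *+ e - U_(j) + U_(i))%MM.
  rewrite -addmA [(U_(i) + _)%MM]addmC addmA; congr (_ + _)%MM.
  by rewrite addmC addmBA 1?addmC // lep1mP -lt0n.
by apply: bI; rewrite // mnmDE; lia.
Qed.

Lemma colon_depends o I : mon_ideal I -> depends o.+1 I -> depends o (colon o I).
Proof.
move=> iI dI; suff colonW u v : (forall i, (i < o)%N -> u i = v i) -> colon o I u -> colon o I v.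
  by move=> u v uv; apply/idP/idP; apply: colonW => // i /uv.
(* This exponent makes v x_o^(e + u_o) agree with the multiple u x_o^e x_o^(v_o) of u x_o^e in x_0,
   ..., x_o. *)
move=> uv /asboolP[e Iu]; apply/asboolP; exists (e + u o)%N.
rewrite (@dI _ (u + U_(o) *+ e + U_(o) *+ v o)%MM) => [|i]; first exact: iI.
rewrite ltnS leq_eqVlt !mnmDE !mulmnE !mnm1E => /predU1P[/val_inj ->|lt_io].
  by rewrite eqxx; lia.
by case: eqVneq lt_io => [->|_ /uv ->]; [rewrite ltnn | rewrite !mul0n !addn0].
Qed.

(* Finitely many generators of the colon ideal share a power of [x_o], which the
   Borel moves then spread over the smaller variables. *)
Lemma colon_finite o I d : mon_ideal I -> mon_borel I -> gen_below d (colon o I) ->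
  exists M, forall t, (M <= t)%N ->
    cnt (fun v => in_vars o.+1 v && (colon o I v && ~~ I v)) t = 0%N.
Proof.
move=> iI bI genJ.
have [E I_E] : exists E, {in monomials N d, forall w, colon o I w -> I (w + U_(o) *+ E)%MM}.
  elim: (monomials N d) => [|w s [E I_E]]; first by exists 0%N.
  have [e I_e] : exists e, colon o I w -> I (w + U_(o) *+ e)%MM.
    by have [/asboolP[e Ie]|_] := boolP (colon o I w); [exists e | exists 0%N].
  have addUD x a b : (x + U_(o) *+ (a + b) = x + U_(o) *+ a + U_(o) *+ b)%MM.
    by apply/mnmP => i; rewrite !mnmDE !mulmnE; lia.
  exists (E + e)%N => x; rewrite inE => /predU1P[->|xs] Jx.
    by rewrite addnC addUD; apply/iI/I_e.
  by rewrite addUD; apply/iI/I_E.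
exists (d + E)%N => t le_t; apply/eqP; rewrite -leqn0 leqNgt; apply/cnt_gt0 => -[v vt].
move=> /and3P[in_v Jv]; apply/negP/negPn.
(* Dividing out variables while staying in the colon ideal reaches some [w] of degree [d]. The
   cofactor [x] then has degree at least [E], so w x_o^(deg x) lies in [I], and [borel_spread]
   applies. *)
have [w [x [def_v wd Jw]]] : exists w x, [/\ v = (w + x)%MM, mdeg w = d & colon o I w].
  have: (d <= mdeg v)%N by lia.
  have [m vm] : exists m, mdeg v = m by exists (mdeg v).
  rewrite vm; elim: m v vm Jv {in_v vt} => [|m IHm] v vm Jv.
    by rewrite leqn0 => /eqP d0; exists v, 0%MM; rewrite addm0 d0.
  rewrite leq_eqVlt => /predU1P[->|lt_dm]; first by exists v, 0%MM; rewrite addm0.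
  have [l v_gt0 Jvl] : exists2 l, (0 < v l)%N & colon o I (v - U_(l))%MM.
    by apply: genJ; rewrite // vm.
  have [||w [x [def_vl wd Jw]]] := IHm _ _ Jvl; [by have := mdeg_subU v_gt0; lia | lia |].
  by exists w, (x + U_(l))%MM; split; rewrite // addmA -def_vl addUK.
have in_x : in_vars o.+1 x.
  by apply/in_varsP => i /(in_varsP _ _ in_v); rewrite def_v mnmDE; lia.
rewrite def_v; apply: (borel_spread bI in_x).
have -> : mdeg x = (E + (mdeg x - E))%N.
  by rewrite subnKC //; move: vt; rewrite def_v mdegD wd; lia.
rewrite (_ : (w + _)%MM = (w + U_(o) *+ E + U_(o) *+ (mdeg x - E))%MM); last first.
  by apply/mnmP => i; rewrite !mnmDE !mulmnE; lia.
by apply/iI/I_E; rewrite // mem_monomials wd.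
Qed.

End Borel.

(** * Borel ideals that omit one monomial of V_g in each degree of an interval *)

Section Removal.
Variables (N : nat) (I : pred 'X_{1..N}) (o : 'I_N) (g : 'X_{1..N}) (c : nat).
Implicit Types (u v w : 'X_{1..N}) (i j l : 'I_N).
Hypotheses (iI : mon_ideal I) (bI : mon_borel I) (dI : depends o.+1 I).
Hypotheses (sIV : forall u, I u -> lex_above g u) (in_g : in_vars o g).
Hypothesis removed1 : forall t,
  cnt (fun v => in_vars o.+1 v && (lex_above g v && ~~ I v)) t =
  (mdeg g <= t < mdeg g + c)%N.

(** Induction on the degree. Only one monomial is removed per degree, so if [u] is lexicographically
    larger than the expected one, [v], it suffices to show that [v] is removed too. *)
Lemma removed_eq u : in_vars o.+1 u -> lex_above g u -> ~~ I u ->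
  exists2 e, (e < c)%N & u = (g + U_(o) *+ e)%MM.
Proof.
have [t ut] : exists t, mdeg u = t by exists (mdeg u).
elim: t u ut => [|t IHt] u ut in_u Vu nIu.
  have t_in : (mdeg g <= 0 < mdeg g + c)%N.
    have: (0 < cnt (fun v => in_vars o.+1 v && (lex_above g v && ~~ I v)) 0)%N.
      by apply/cnt_gt0; exists u; rewrite ?in_u ?Vu.
    by rewrite removed1 lt0b.
  exists 0%N; first lia.
  move/eqP: ut; rewrite mdeg_eq0 => /eqP ->; rewrite mulm0n addm0.
  by apply/esym/eqP; rewrite -mdeg_eq0; lia.
have t_in : (mdeg g <= t.+1 < mdeg g + c)%N.
  have: (0 < cnt (fun v => in_vars o.+1 v && (lex_above g v && ~~ I v)) t.+1)%N.
    by apply/cnt_gt0; exists u; rewrite ?in_u ?Vu.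
  by rewrite removed1 lt0b.
pose e := (t.+1 - mdeg g)%N; pose v := (g + U_(o) *+ e)%MM.
have vt : mdeg v = t.+1 by rewrite mdegD mdegMn mdeg1; lia.
have in_v : in_vars o.+1 v by apply: in_vars_addU => //; apply: in_varsW in_g.
have Vv : lex_above g v by apply: lex_above_ideal; rewrite /lex_above lex_irr.
have degU a : mdeg (g + U_(o) *+ a)%MM = t.+1 -> a = e by rewrite mdegD mdegMn mdeg1; lia.
exists e; first lia.
(* If u < v, then [u] lies between x^g and x^g x_o^e, hence is some x^g x_o^a, and its degree gives
   a = e. *)
case: (lex_total u v) => // [gt_uv|gt_vu]; last first.
  have [|a lt_ae def_u] := lex_above_addUP e in_g in_u _; first by rewrite Vu negbK.
  by rewrite def_u (degU a) // -def_u.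
have [j eq_j lt_j] := lex_gtP _ _ gt_uv.
(* If the first difference were at x_o, then [u] would be x^g times a power of x_o, and its degree
   would make it [v]. *)
have lt_jo : (j < o)%N.
  rewrite ltnNge leq_eqVlt; apply/negP => /predU1P[/val_inj eq_oj|lt_oj]; last first.
    by move: lt_j; rewrite (in_varsP _ _ in_u).
  have def_u : u = (g + U_(o) *+ u o)%MM.
    apply/mnmP => i; case: (ltngtP i o) => [lt_io|lt_oi|/val_inj ->].
    - by rewrite addU_coord // eq_j ?addU_coord // -eq_oj.
    - rewrite (in_varsP _ _ in_u) // mnmDE mulmnE mnm1E (in_varsP _ _ in_g) 1?ltnW //.
      by case: eqVneq lt_oi => // ->; rewrite ltnn.
    by rewrite mnmDE mulmnE mnm1E eqxx (in_varsP _ _ in_g) // mul1n.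
  by move: lt_j; rewrite def_u (degU (u o)) ?ltnn // -def_u.
have gj a : (g + U_(o) *+ a)%MM j = g j by apply: addU_coord.
have eq_gj i : (i < j)%N -> u i = g i.
  by move=> lt_ij; rewrite eq_j // addU_coord // (ltn_trans lt_ij).
rewrite gj in lt_j.
(* Dividing u by a variable x_l keeps it above g, hence in I, unless
   u = v x_j / x_l is a Borel move of v, which then is a second removed monomial. *)
have no_div l : (0 < u l)%N -> (g j < (u - U_(l))%MM j)%N -> (j <= l)%N -> False.
  move=> u_gt0 lt_gw le_jl; have def_u := addUK u_gt0; case/negP: nIu.
  have wt : mdeg (u - U_(l))%MM = t by have := mdeg_subU u_gt0; lia.
  rewrite -def_u; apply: iI; apply: contraT => nIw.
  have gt_w : lex_gt (u - U_(l))%MM g.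
    apply/lex_gtP; exists j => // i lt_ij; rewrite mnmBE mnm1E eq_gj //.
    by case: eqVneq le_jl => [->|]; [lia | rewrite subn0].
  have [|a _ def_w] := IHt _ wt _ (lex_gt_above gt_w) nIw; first exact: in_varsB.
  by move: lt_gw; rewrite def_w gj ltnn.
have u_j : u j = (g j).+1.
  apply/eqP; rewrite eqn_leq lt_j andbT leqNgt; apply/negP => lt_gj.
  by apply: (no_div j); rewrite ?mnmBE ?mnm1E ?eqxx //; lia.
have u_gtj i : (j < i)%N -> u i = 0%N.
  move=> lt_ji; apply/eqP; rewrite -leqn0 leqNgt; apply/negP => u_gt0.
  apply: (no_div i); rewrite ?(ltnW lt_ji) // mnmBE mnm1E.
  by case: eqVneq lt_ji => [->|]; rewrite ?ltnn ?subn0.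
have uj_gt0 : (0 < u j)%N by lia.
(* [w] agrees with [v] up to x_j and has no later variable, so it divides [v]; by degrees the
   quotient is a single variable x_l, with l > j. *)
pose w := (u - U_(j))%MM.
have w_j : w j = v j by rewrite mnmBE mnm1E eqxx u_j gj subn1.
have le_wv : (w <= v)%MM.
  apply/mnm_lepP => i; case: (ltngtP i j) => [lt_ij|lt_ji|/val_inj ->].
  - by rewrite -eq_j // mnmBE leq_subr.
  - by rewrite mnmBE u_gtj.
  by rewrite w_j.
have wt : mdeg w = t by have := mdeg_subU uj_gt0; rewrite /w; lia.
have [l /eqP def_vw] : exists l, (v - w == U_(l))%MM.
  by apply/mdeg1P; have := mdegD (v - w) w; rewrite submK // vt wt; lia.
have def_v : (U_(l) + w = v)%MM by rewrite -def_vw submK.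
have lt_jl : (j < l)%N.
  have := congr1 (fun x : 'X_{1..N} => x l) def_v; rewrite mnmDE mnm1E eqxx.
  case: (ltngtP l j) => // [lt_lj|/val_inj ->]; last by rewrite w_j; lia.
  rewrite mnmBE mnm1E -eq_j //; case: eqVneq lt_lj => [->|]; rewrite ?ltnn // subn0; lia.
(* The Borel move from x_l to x_j sends [v] to [u]. *)
have nIv : ~~ I v.
  apply: contra nIu => Iv; have := bI Iv lt_jl.
  by rewrite -{1}def_v mnmDE mnm1E eqxx -def_v [(U_(l) + w)%MM]addmC addmK addUK //; apply.
apply: (@cnt_le1 _ (fun v => in_vars o.+1 v && (lex_above g v && ~~ I v)) t.+1) => //.
- by rewrite removed1; case: (_ && _).
- by rewrite in_u Vu.
by rewrite in_v Vv.
Qed.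

(** By [removed_eq] and [lex_above_addUP], both ideals arise from V_g by deleting the monomials x^g
    x_o^e with e < c. *)
Lemma removal_lex : I =1 lex_above (g + U_(o) *+ c)%MM.
Proof.
have in_g' : in_vars o.+1 (g + U_(o) *+ c)%MM.
  by apply: in_vars_addU => //; apply: in_varsW in_g.
apply: (depends_ext dI (lex_above_depends in_g')) => u in_u.
have addUP := lex_above_addUP c in_g in_u; apply/idP/idP => [Iu|Uu].
  apply: contraT => nUu; have [|e lt_ec def_u] := addUP _; first by rewrite sIV.
  have /cnt_gt0[x xt /and3P[in_x Vx nIx]] :
      (0 < cnt (fun v => in_vars o.+1 v && (lex_above g v && ~~ I v)) (mdeg u))%N.
    by rewrite removed1 lt0b def_u mdegD mdegMn mdeg1; lia.
  have [a _ def_x] := removed_eq in_x Vx nIx; case/negP: nIx.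
  move: xt; rewrite def_x def_u !mdegD !mdegMn !mdeg1 => xt.
  by rewrite (_ : a = e) -?def_u //; lia.
have Vu := lex_above_addU_sub in_g Uu; apply: contraT => nIu.
have /addUP : exists2 e, (e < c)%N & u = (g + U_(o) *+ e)%MM by apply: removed_eq.
by rewrite Uu andbF.
Qed.

End Removal.

(** * Induction on the number of variables *)

Section Domination.
Variable N : nat.
Implicit Types (I J : pred 'X_{1..N}) (g u v w : 'X_{1..N}) (i j o l : 'I_N).

(** The induction statement for an ideal in x_0, ..., x_(k-1). Hilbert functions are taken with the
    extra variable x_k, since the next step works in that ring; [dom_gap] is the dichotomy between
    equality and a strict drop of degree. *)
Record lex_dominates (k : nat) g I : Prop := LexDominates {
  dom_vars : in_vars k g;
  dom_le : forall t, (hilb_vars k.+1 (lex_above g) t <= hilb_vars k.+1 I t)%N;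
  dom_eq : forall t, (mdeg g <= t)%N ->
    hilb_vars k.+1 (lex_above g) t = hilb_vars k.+1 I t;
  dom_gen : gen_below (mdeg g) I;
  dom_K : forall s, (mdeg g + k <= s)%N -> Kseries (lex_above g) s = 0%R;
  dom_gap : I =1 lex_above g \/
    exists t, Kseries (lex_above g) t != 0%R /\ forall s, (t <= s)%N -> Kseries I s = 0%R }.

Lemma Kseries_eq1 I J : I =1 J -> Kseries I =1 Kseries J.
Proof. by move=> /funext ->. Qed.

Lemma hilb_vars_colon I o t : mon_ideal I ->
  hilb_vars o.+1 I t = (hilb_vars o.+1 (colon o I) t +
    cnt (fun v => in_vars o.+1 v && (colon o I v && ~~ I v)) t)%N.
Proof.
move=> iI; rewrite /hilb_vars [LHS](cntID _ (colon o I)) addnC.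
congr (_ + _)%N; apply: cnt_eq => v _.
  case Iv: (I v); first by rewrite (sub_colon o Iv) !andbF.
  by rewrite andbT.
by rewrite -andbA [(~~ I v && _)]andbC.
Qed.

(** The monomials x^g x_o^e with e < c have distinct degrees, which fill the interval. *)
Lemma hilb_vars_lex_addU o g c t : in_vars o g ->
  hilb_vars o.+1 (lex_above (g + U_(o) *+ c)%MM) t =
  (hilb_vars o.+1 (lex_above g) t + (mdeg g <= t < mdeg g + c))%N.
Proof.
move=> in_g; rewrite /hilb_vars [LHS](cntID _ (lex_above g)) addnC; congr (_ + _)%N.
  apply: cnt_eq => v _; rewrite -andbA; congr (_ && _).
  case Vv: (lex_above g v); rewrite ?andbF ?andbT //=.
  by apply: contraFN Vv; apply: lex_above_addU_sub.
have addUP u : in_vars o.+1 u -> _ := @lex_above_addUP _ o g c u in_g.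
have [t_in|t_in] := boolP (mdeg g <= t < mdeg g + c)%N; last first.
  apply/eqP; rewrite -leqn0 leqNgt; apply/cnt_gt0 => -[v vt /andP[/andP[in_v nUv] Vv]].
  have [|e lt_ec def_v] := addUP v in_v _; first by rewrite Vv.
  by move: vt t_in; rewrite def_v mdegD mdegMn mdeg1; lia.
pose x := (g + U_(o) *+ (t - mdeg g))%MM.
have in_x : in_vars o.+1 x by apply: in_vars_addU => //; apply: in_varsW in_g.
rewrite (@cnt_eq _ _ (pred1 x)) ?cnt_pred1 => [|v vt].
  by rewrite mdegD mdegMn mdeg1; apply/eqP; lia.
apply/idP/eqP => [/andP[/andP[in_v nUv] Vv]|->].
  have [|e lt_ec def_v] := addUP v in_v _; first by rewrite Vv.
  move: vt; rewrite def_v mdegD mdegMn mdeg1 => vt; rewrite /x.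
  by congr (_ + _ *+ _)%MM; lia.
rewrite in_x andbC; apply/addUP => //; exists (t - mdeg g)%N => //; lia.
Qed.

Lemma lex_dominates_step o g I : (o.+1 < N)%N ->
  mon_ideal I -> mon_borel I -> depends o.+1 I ->
  lex_dominates o g (colon o I) -> exists g', lex_dominates o.+1 g' I.
Proof.
move=> lt_oN iI bI dI; set J := colon o I; set V := lex_above g; set d := mdeg g.
move=> [in_g le_VJ eq_VJ genJ K_V gapJ]; rewrite -/V -/d in le_VJ eq_VJ genJ K_V gapJ.
have lt_o1 : (o.+1 < N)%N := lt_oN; pose o1 := Ordinal lt_o1.
have dJ : depends o J := colon_depends iI dI.
have dV : depends o V := lex_above_depends in_g.
have dJ1 : depends o.+1 J := dependsW (leqnSn o) dJ.
have dV1 : depends o.+1 V := dependsW (leqnSn o) dV.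
(* [f] is H_I - H_J. *)
pose f t := cnt (fun v => in_vars o.+1 v && (J v && ~~ I v)) t.
have f0_I t : f t = 0%N -> forall v, mdeg v = t -> in_vars o.+1 v -> J v -> I v.
  move=> /cnt_eq0 ft v vt in_v Jv; have := ft v vt; rewrite in_v Jv /=; exact: negbNE.
(* Once [I] and [J] agree in a degree t >= d they agree in the next one, because [J] has no
   generators there. *)
have f_gap t : (d <= t)%N -> f t = 0%N -> f t.+1 = 0%N.
  move=> le_dt ft; apply/eqP; rewrite -leqn0 leqNgt; apply/cnt_gt0 => -[v vt].
  case/and3P=> in_v Jv /negP; apply.
  have [|l v_gt0 Jw] := genJ v Jv; first by rewrite vt.
  rewrite -(addUK v_gt0); apply/iI/(f0_I _ ft) => //; last exact: in_varsB.
  by have := mdeg_subU v_gt0; lia.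
have [M fM] := colon_finite iI bI genJ.
(* This is H_I - H_V; the truncated subtraction is exact because H_V <= H_J. *)
pose F t := (f t + (hilb_vars o.+1 J t - hilb_vars o.+1 V t))%N.
have F_f t : (d <= t)%N -> F t = f t by move=> le_dt; rewrite /F eq_VJ // subnn addn0.
have F_gap t : (d <= t)%N -> F t = 0%N -> F t.+1 = 0%N.
  by move=> le_dt; rewrite !F_f ?(leqW le_dt) //; apply: f_gap.
have F_fin t : (d + M <= t)%N -> F t = 0%N by move=> le_t; rewrite F_f ?/f ?fM //; lia.
have [S_le S_eq F_out F_last] := staircase F_gap F_fin erefl.
set c := (\sum_(0 <= s < d + M) F s)%N in S_le S_eq F_out F_last.
have hI t : hilb_vars o.+1 I t = (hilb_vars o.+1 V t + F t)%N.
  by rewrite hilb_vars_colon // /F /f -/J; have := le_VJ t; lia.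
pose g' := (g + U_(o) *+ c)%MM; pose U := lex_above g'.
have d' : mdeg g' = (d + c)%N by rewrite mdegD mdegMn mdeg1 mul1n.
have in_g' : in_vars o.+1 g' by apply: in_vars_addU => //; apply: in_varsW in_g.
have dU : depends o.+1 U := lex_above_depends in_g'.
have hU t : hilb_vars o.+1 U t = (hilb_vars o.+1 V t + (d <= t < d + c))%N.
  exact: hilb_vars_lex_addU.
(* The new variable x_(o+1) turns Hilbert functions into partial sums, which [staircase]
   compares. *)
have sum_I t : hilb_vars o.+2 I t =
    (\sum_(0 <= s < t.+1) hilb_vars o.+1 V s + \sum_(0 <= s < t.+1) F s)%N.
  by rewrite (@hilb_vars_sum _ o1) // -big_split; apply: eq_bigr => s _; rewrite hI.
have sum_U t : hilb_vars o.+2 U t =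
    (\sum_(0 <= s < t.+1) hilb_vars o.+1 V s + \sum_(0 <= s < t.+1) (d <= s < d + c))%N.
  by rewrite (@hilb_vars_sum _ o1) // -big_split; apply: eq_bigr => s _; rewrite hU.
have le_o1N : (o.+1 <= N)%N by apply: ltnW.
have KE (P : pred 'X_{1..N}) (a : nat -> nat) : depends o.+1 P ->
    (forall t, hilb_vars o.+1 P t = (hilb_vars o.+1 V t + a t)%N) ->
    forall t, Kseries P t = (Kseries V t + iter o.+1 diff (fun s => Posz (a s)) t)%R.
  move=> dP hP t; rewrite !(@Kseries_hilb_vars _ o.+1) // -iter_diffD.
  by congr (iter _ _ _ t); apply: funext => s; rewrite hP PoszD.
have K_U := KE U _ dU hU.
exists g'; split; rewrite ?d' -?/U //.
- by move=> t; rewrite sum_U sum_I leq_add2l.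
- by move=> t le_t; rewrite sum_U sum_I S_eq // leqW.
(* A variable after x_o can be divided out freely. Otherwise division within [J] leads to a degree
   at least d + c, where [F] vanishes and so [I] and [J] agree. *)
- move=> u Iu lt_u.
  have [/existsP[l]|/existsPn u0] := boolP [exists l : 'I_N, (o < l)%N && (0 < u l)%N].
    by case/andP=> lt_ol u_gt0; exists l; rewrite // (depends_subU _ _ dI).
  have in_u : in_vars o.+1 u.
    by apply/in_varsP => l lt_ol; have := u0 l; rewrite lt_ol -eqn0Ngt => /eqP.
  have [|l u_gt0 Jw] := genJ u (sub_colon o Iu); first by rewrite -/d; lia.
  exists l => //; have deg_w := mdeg_subU u_gt0.
  apply: (f0_I (mdeg (u - U_(l))%MM)) => //; last exact: in_varsB.
  by rewrite -F_f ?F_out //; lia.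
- move=> s le_s; rewrite K_U K_V ?add0r; last lia.
  apply: (@iter_diff_vanish _ _ (d + c)) => [t le_t|]; last lia.
  by case: andP => // -[]; lia.
(* For c = 0 the three ideals reduce to the old situation: I = J and g' = g. *)
have [c0|c_gt0] := posnP c.
  have F0 t : F t = 0%N.
    have [le_t|lt_t] := leqP (d + M) t; first exact: F_fin.
    move: c0; rewrite /c big_mkord => /eqP; rewrite sum_nat_eq0 => /forallP/(_ (Ordinal lt_t)).
    by move/eqP.
  have g'g : g' = g by rewrite /g' c0 mulm0n addm0.
  have IJ : I =1 J.
    apply: (depends_ext dI dJ1) => u in_u; apply/idP/idP => [|Ju]; first exact: sub_colon.
    by apply: (f0_I (mdeg u)) => //; have := F0 (mdeg u); rewrite /F; lia.
  rewrite /U g'g -/V; have KIJ := Kseries_eq1 IJ.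
  case: gapJ => [JV|[t [Vt Jt]]]; [left => u; rewrite IJ; exact: JV | right].
  by exists t; split=> // s /Jt; rewrite KIJ.
(* K_V vanishes in this degree; what remains is the leading coefficient contributed by the last
   point d + c - 1 of the indicator. *)
have K_Ut : Kseries U (d + c + o)%N != 0%R.
  rewrite K_U K_V ?add0r; last lia.
  have -> : (d + c + o = (d + c).-1 + o.+1)%N by lia.
  rewrite iter_diff_top => [|s lt_s].
    have -> : (d <= (d + c).-1 < d + c)%N by lia.
    by rewrite mulr1 signr_eq0.
  by case: andP => // -[]; lia.
have K_J s : (d + o <= s)%N -> Kseries J s = 0%R.
  move=> le_s; case: gapJ => [/Kseries_eq1 ->|[t [Vt Jt]]]; first exact: K_V.
  apply: Jt; apply: leq_trans le_s; rewrite leqNgt.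
  by apply: contra Vt => lt_t; rewrite K_V // ltnW.
have K_I t : Kseries I t = (Kseries J t + iter o.+1 diff (fun s => Posz (f s)) t)%R.
  rewrite !(@Kseries_hilb_vars _ o.+1) // -iter_diffD.
  by congr (iter _ _ _ t); apply: funext => s; rewrite hilb_vars_colon // PoszD.
(* If [f] vanishes at d + c - 1, then K_I vanishes from degree d + c + o on, where K_U does not.
   Otherwise [F] is the indicator. *)
have [f_last|f_last] := posnP (f (d + c).-1).
  right; exists (d + c + o)%N; split=> // s le_s; rewrite K_I K_J ?add0r; last lia.
  apply: (@iter_diff_vanish _ _ (d + c).-1) => [t le_t|]; last lia.
  have [lt_t|{}le_t] := ltnP t (d + c)%N.
    by rewrite (_ : t = (d + c).-1) ?f_last //; lia.
  by rewrite -F_f ?F_out //; lia.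
have F_ind : forall t, F t = (d <= t < d + c)%N by apply: F_last; rewrite // F_f //; lia.
(* Below [d] the indicator is zero, so H_J = H_V everywhere. Then K_J = K_V, which rules out the
   strict alternative for [J]. *)
have hJV t : hilb_vars o.+1 J t = hilb_vars o.+1 V t.
  have [le_dt|lt_td] := leqP d t; first by rewrite eq_VJ.
  by have := F_ind t; have := le_VJ t; rewrite /F; lia.
have JV : J =1 V.
  case: gapJ => // -[t [/eqP Vt Jt]]; case: Vt; rewrite -(Jt t) //.
  rewrite !(@Kseries_hilb_vars _ o.+1) //.
  by congr (iter _ _ _ t); apply: funext => s; rewrite hJV.
left; apply: removal_lex => // [u Iu|t]; first by rewrite -[lex_above g u]JV; apply: sub_colon.
rewrite -F_ind /F hJV subnn addn0; apply: cnt_eq => v _.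
by rewrite -[lex_above g v]JV.
Qed.

Lemma lex_dominates_exists k I : (k < N)%N ->
  mon_ideal I -> mon_borel I -> mon_nonzero I -> depends k I -> exists g, lex_dominates k g I.
Proof.
elim: k I => [|k IHk] I lt_kN iI bI [x Ix] dI; last first.
  have lt_k : (k < N)%N by lia.
  have [||||g domJ] := IHk (colon (Ordinal lt_k) I) lt_k.
  - exact: colon_ideal.
  - exact: colon_borel.
  - by exists x; apply: sub_colon.
  - exact: (@colon_depends _ (Ordinal lt_k)).
  exact: (@lex_dominates_step (Ordinal lt_k) g).
(* With no variables available, a nonzero ideal is the unit ideal, which is V_0. *)
have in_0 : in_vars 0 (0%MM : 'X_{1..N}) by apply/in_varsP => i _; rewrite mnm0E.
have IV : I =1 lex_above 0%MM.
  move=> u; rewrite (_ : I u = true) ?(dI u x) //; apply/esym/negP => /lex_gtP[i _].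
  by rewrite mnm0E.
have K0 s : Kseries (lex_above (0%MM : 'X_{1..N})) s = 0%R.
  rewrite (Kseries_hilb_vars _ (leq0n N) (lex_above_depends in_0)) /=; congr Posz.
  apply/eqP; rewrite -leqn0 leqNgt; apply/cnt_gt0 => -[v _].
  by rewrite -IV (dI v x) // Ix andbF.
exists 0%MM; split=> //; last by left.
- by move=> t; rewrite (funext IV).
- by move=> t _; rewrite (funext IV).
move=> u Iu; rewrite mdeg0 => /mdeg_gt0P[l u_gt0]; exists l => //.
by rewrite (dI _ u).
Qed.

End Domination.

(** * Identification of the lexicographic ideal and conclusion *)

Section LexIdeal.
Variable N : nat.
Implicit Types (I : pred 'X_{1..N}) (g u v w : 'X_{1..N}) (o : 'I_N).

Lemma dim_in_add_hilb I t : (dim_in I t + hilb I t = cnt (@predT 'X_{1..N}) t)%N.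
Proof.
by rewrite [RHS](cntID _ I) /dim_in card_cnt /hilb (card_cnt (fun v => ~~ I v)).
Qed.

(** If [u] is not in V_g, every monomial of V_g in its degree is larger, and there are at least dim
    I_d of these, with d = deg u. *)
Lemma lex_segment_sub g I u :
  (hilb (lex_above g) (mdeg u) <= hilb I (mdeg u))%N -> lex_segment I u -> lex_above g u.
Proof.
move=> le_h; apply: contraTT => nVu; rewrite /lex_segment (card_cnt (fun v => lex_gt v u)) -leqNgt.
apply: (@leq_trans (dim_in (lex_above g) (mdeg u))).
  have := dim_in_add_hilb I (mdeg u); have := dim_in_add_hilb (lex_above g) (mdeg u); lia.
rewrite /dim_in card_cnt; apply: cnt_le => v _ Vv.
case: (lex_total v u) => // [eq_vu|/(lex_above_up Vv) Vu]; last by case/negP: nVu.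
by case/negP: nVu; rewrite -eq_vu.
Qed.

(** All larger monomials of the same degree lie in V_g, and [u] itself makes the count strict. *)
Lemma lex_segment_sup g I u :
  hilb (lex_above g) (mdeg u) = hilb I (mdeg u) -> lex_above g u -> lex_segment I u.
Proof.
move=> eq_h Vu; rewrite /lex_segment (card_cnt (fun v => lex_gt v u)).
have -> : dim_in I (mdeg u) = dim_in (lex_above g) (mdeg u).
  have := dim_in_add_hilb I (mdeg u); have := dim_in_add_hilb (lex_above g) (mdeg u); lia.
rewrite /dim_in card_cnt (cntID (lex_above g) (fun v => lex_gt v u)).
apply: (@leq_ltn_trans (cnt (fun v => lex_above g v && lex_gt v u) (mdeg u))).
  by apply: cnt_le => v _ gt_vu; rewrite gt_vu (lex_above_up Vu).
rewrite -[ltnLHS]addn0 ltn_add2l; apply/cnt_gt0; exists u => //.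
by rewrite Vu lex_irr.
Qed.

(** Saturation sees only large degrees, where the lex segment is V_g; conversely, V_g is unaffected
    by powers of x_o, so u x_o^e in V_g gives [u] in V_g. *)
Lemma lex_ideal_above o g I d : in_vars o g ->
    (forall t, (hilb (lex_above g) t <= hilb I t)%N) ->
    (forall t, (d <= t)%N -> hilb (lex_above g) t = hilb I t) ->
  lex_ideal I =1 lex_above g.
Proof.
move=> in_g le_h eq_h u; apply/asboolP/idP => [[e sat_u]|Vu].
  have := sat_u (U_(o) *+ e)%MM; rewrite mdegMn mdeg1 mul1n => /(_ erefl).
  by move/(lex_segment_sub (le_h _)); rewrite (depends_addU _ _ _ (lex_above_depends in_g)).
exists d => v vd; apply: (@lex_segment_sup g); last exact: lex_above_ideal.
by rewrite eq_h // mdegD vd leq_addl.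
Qed.

(** If u x_o^e is in [I], Borel moves put u v in [I] for every [v] of degree [e], and saturation
    gives [u] in [I]; hence the last variable can be cancelled. *)
Lemma saturated_borel_depends o I : N = o.+1 ->
  mon_ideal I -> mon_borel I -> mon_saturated I -> depends o I.
Proof.
move=> defN iI bI sI.
have dropU u e : I (u + U_(o) *+ e)%MM -> I u.
  move=> Iu; rewrite -sI; apply/asboolP; exists e => v ve.
  by apply: (borel_spread (o := o) bI); [rewrite -defN in_vars_full | rewrite ve].
suff dW u v : (forall i : 'I_N, (i < o)%N -> u i = v i) -> I u -> I v.
  by move=> u v uv; apply/idP/idP; apply: dW => // i /uv.
move=> uv Iu; apply: (dropU _ (u o)).
have -> : (v + U_(o) *+ u o = u + U_(o) *+ v o)%MM; last exact: iI.
apply/mnmP => i; rewrite !mnmDE !mulmnE !mnm1E.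
have : (i <= o)%N by have := ltn_ord i; rewrite [in X in (_ < X)%N -> _]defN.
rewrite leq_eqVlt => /predU1P[/val_inj ->|lt_io]; first by rewrite eqxx; lia.
by case: eqVneq lt_io => [->|_ /uv ->]; rewrite ?ltnn.
Qed.

End LexIdeal.

Theorem theorem6p10 (n : nat) (I : pred 'X_{1..n.+1}) :
  mon_ideal I -> mon_nonzero I -> mon_proper I ->
  mon_saturated I -> mon_borel I ->
  ~ (forall u, I u = lex_ideal I u) ->
  Kdeg_gt (lex_ideal I) I.
Proof.
move=> iI nzI _ sI bI neq_I.
have dI : depends (@ord_max n) I by apply: saturated_borel_depends.
(* At k = n the extra variable is the last one x_n, so the Hilbert functions compared are those of
   the full ring. *)
have [g [in_g le_h eq_h _ _ gap]] := lex_dominates_exists (ltnSn n) iI bI nzI dI.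
have lexE : lex_ideal I =1 lex_above g.
  apply: (@lex_ideal_above _ ord_max _ _ (mdeg g)) => // t; rewrite !hilbE //; exact: eq_h.
case: gap => [IV|[t [nz_t I_t]]]; first by case: neq_I => u; rewrite lexE.
exists t; split; first by rewrite KcoefE (funext lexE).
by move=> s /I_t; rewrite KcoefE.
Qed.
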